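(* Let $a,b\in\mathbb{Q}$. For every integer $n\ge 0$, the Hankel transform $(h_n)_{n\ge 0}$ of the sequence $(aC_{n+2}+bC_{n+3})_{n\ge 0}$ is given by $$h_n=[x^{n+1}]\,\frac{1-b^2x^2}{1-(2a+5b)x+(a^2+6ab+10b^2)x^2-(a^2+6ab+10b^2)b\,x^3+(2a+5b)b^3x^4-b^5x^5}.$$
   Context: $C_n=\frac{1}{n+1}\binom{2n}{n}$ denotes the $n$-th Catalan number ($1,1,2,5,14,\ldots$). The Hankel transform of a sequence $(s_n)_{n\ge 0}$ is the sequence $(h_n)_{n\ge 0}$ with $h_n=\det(s_{i+j})_{0\le i,j\le n}$. $[x^m]F(x)$ denotes the coefficient of $x^m$ in the formal power series $F(x)$. *)

(* Defs.v *)
From mathcomp Require Import all_boot all_order all_algebra.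

Set Implicit Arguments.
Unset Strict Implicit.
Unset Printing Implicit Defensive.

Import GRing.Theory.
Local Open Scope ring_scope.

Definition catalan (n : nat) : rat := ('C(n.*2, n))%:R / (n.+1)%:R.

Definition hankel (R : comNzRingType) (s : nat -> R) (n : nat) : R :=
  \det (\matrix_(i < n.+1, j < n.+1) s (i + j)%N).

(* Formal power series are represented by their coefficient sequences. *)
Definition fps (R : Type) : Type := nat -> R.

Definition fps_coef (R : Type) (m : nat) (F : fps R) : R := F m.

Definition fps_of_poly (R : nzRingType) (p : {poly R}) : fps R := fun m => p`_m.

Definition fps_mul (R : nzRingType) (F G : fps R) : fps R :=
  fun m => \sum_(k < m.+1) F k * G (m - k)%N.

(* The first n coefficients of 1/F, obtained by solving F * G = 1 degree by
   degree: G_0 = 1/F_0 and G_m = - (F_1 G_(m-1) + ... + F_m G_0) / F_0. *)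
Fixpoint fps_inv_seq (R : fieldType) (F : fps R) (n : nat) : seq R :=
  if n is m.+1 then
    let g := fps_inv_seq F m in
    rcons g (((m == 0)%N%:R - \sum_(k < m) F k.+1 * g`_(m - k.+1)%N) / F 0%N)
  else [::].

(* Meaningful only when F 0 != 0. *)
Definition fps_inv (R : fieldType) (F : fps R) : fps R :=
  fun m => (fps_inv_seq F m.+1)`_m.

Definition fps_div (R : fieldType) (F G : fps R) : fps R :=
  fps_mul F (fps_inv G).

Lemma size_fps_inv_seq (R : fieldType) (F : fps R) n :
  size (fps_inv_seq F n) = n.
Proof. by elim: n => //= n IH; rewrite size_rcons IH. Qed.

Lemma nth_fps_inv_seq (R : fieldType) (F : fps R) n m :
  (m < n)%N -> (fps_inv_seq F n)`_m = fps_inv F m.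
Proof.
elim: n => // n IH; rewrite ltnS leq_eqVlt => /orP[/eqP-> //|lt_mn].
by rewrite /= nth_rcons size_fps_inv_seq lt_mn IH.
Qed.

Lemma fps_invE (R : fieldType) (F : fps R) m :
  fps_inv F m =
  ((m == 0)%N%:R - \sum_(k < m) F k.+1 * fps_inv F (m - k.+1)%N) / F 0%N.
Proof.
rewrite {1}/fps_inv /= nth_rcons size_fps_inv_seq ltnn eqxx.
congr ((_ - _) / _); apply: eq_bigr => k _.
by rewrite nth_fps_inv_seq // ltn_subrL /= (leq_trans _ (ltn_ord k)).
Qed.

Lemma fps_mulV (R : fieldType) (F : fps R) :
  F 0%N != 0 -> fps_mul F (fps_inv F) =1 fps_of_poly 1.
Proof.
move=> F0 m; rewrite /fps_mul big_ord_recl subn0 fps_invE mulrC divfK //.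
by rewrite subrK /fps_of_poly coef1.
Qed.

(* Main.v *)
Require Import Defs.
From mathcomp Require Import all_boot all_order all_algebra.
From mathcomp Require Import ring zify.

Set Implicit Arguments.
Unset Strict Implicit.
Unset Printing Implicit Defensive.

Import GRing.Theory.
Local Open Scope ring_scope.

(** The shifted Catalan numbers C_{n+1} are the moments L(x^n) of a
    functional L whose monic orthogonal polynomials U_k satisfy the constant-coefficient
    recurrence x U_k = U_{k+1} + 2 U_k + U_{k-1} and have L(U_k^2) = 1.  Let J_N
    be the N x N tridiagonal matrix with 2 on the diagonal and 1 beside it, that
    is, multiplication by x in the basis (U_k), truncated.  Let B be the
    unitriangular matrix of the coordinates of the powers x^i in this basis; its
    entries are the ballot numbers below.

    The Hankel matrix of a C_{n+2} + b C_{n+3} = L(x (a + b x) x^n) is B M B^T,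
    with M the truncation of multiplication by x (a + b x).  This M differs from
    the product J_N (a + b J_N) of truncations only in the last diagonal entry,
    and there by b ([catalan_comb_mx]).  Expanding along the last row, the N x N
    Hankel determinant D_N satisfies
      D_N = det J_N det (a + b J_N) + b D_{N-1},
    because the last corner minor of the Hankel matrix is the preceding Hankel
    matrix ([hankel_minor_catalan_rec]).  Here det J_N = N + 1, and
    w_N = det (a + b J_N) satisfies the recurrence of a Toeplitz tridiagonal
    determinant, whose generating function is 1/P with
    P = 1 - (a + 2b) x + b^2 x^2.

    In terms of generating functions, (1 - b x) sum D_m x^m = sum (m + 1) w_m x^m.
    The right-hand side is (x/P)' = (1 - b^2 x^2)/P^2.  The
    denominator of the theorem is (1 - b x) P^2, and a quotient of power series
    is determined by its product with the denominator ([fps_div_unique]). *)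

(** * Toeplitz tridiagonal determinants *)

Definition tridiag (R : pzRingType) (x y : R) (n : nat) : 'M[R]_n :=
  \matrix_(i < n, j < n)
    (x *+ (i == j) + y *+ (i.+1 == j) + y *+ (j.+1 == i)).

Lemma det_tridiag0 (R : comNzRingType) (x y : R) : \det (tridiag x y 0) = 1.
Proof. exact: det_mx00. Qed.

Lemma det_tridiag1 (R : comNzRingType) (x y : R) : \det (tridiag x y 1) = x.
Proof. by rewrite det_mx11 mxE /= mulr1n !addr0. Qed.

(** Expansion along the first row, then along the first column of the second
    minor: deleting leading rows and columns of a Toeplitz matrix leaves a
    smaller matrix of the same shape. *)
Lemma det_tridiagSS (R : comNzRingType) (x y : R) (n : nat) :
  \det (tridiag x y n.+2) =
  x * \det (tridiag x y n.+1) - y ^+ 2 * \det (tridiag x y n).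
Proof.
rewrite (expand_det_row _ ord0) !big_ord_recl big1 => [|j _]; last first.
  by rewrite mxE /= !addr0 mul0r.
rewrite /cofactor !mxE /= !mulr1n !mulr0n !addr0 !add0r expr0 mul1r expr1.
congr (_ * \det _ + _).
  by apply/matrixP => i j; rewrite !mxE -!val_eqE /=.
rewrite mulN1r mulrN expr2 -mulrA; congr (- (_ * _)).
rewrite (expand_det_col _ ord0) big_ord_recl big1 => [|i _]; last first.
  by rewrite !mxE -!val_eqE /= !addr0 mul0r.
rewrite /cofactor !mxE -!val_eqE /= ?mulr1n ?mulr0n ?addr0 ?add0r expr0 mul1r.
congr (_ * \det _).
by apply/matrixP => i j; rewrite !mxE -!val_eqE /=.
Qed.

Lemma det_tridiag21 (R : comNzRingType) (n : nat) :
  \det (tridiag (2 : R) 1 n) = n.+1%:R.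
Proof.
have [] : \det (tridiag (2 : R) 1 n) = n.+1%:R /\
          \det (tridiag (2 : R) 1 n.+1) = n.+2%:R.
  elim: n => [|n [IH0 IH1]]; first by rewrite det_tridiag0 det_tridiag1.
  split=> //; rewrite det_tridiagSS IH0 IH1 expr1n mul1r.
  by rewrite -!natr1; ring.
by [].
Qed.

(** * The ballot triangle *)

(** The coordinate of x^i on U_k.  This form of the difference of binomials,
    with lower indices beyond the middle, vanishes for k > i without any
    truncated subtraction. *)
Definition ballot (i k : nat) : rat :=
  'C(i.*2.+1, (i + k).+1)%:R - 'C(i.*2.+1, (i + k).+2)%:R.

(** Two steps of Pascal's rule: the binomial analogue of multiplication by
    x = 2 + (shift) + (inverse shift). *)
Lemma natr_binSS (R : pzRingType) (m r : nat) :
  'C(m.+2, r.+2)%:R =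
  'C(m, r)%:R + 'C(m, r.+1)%:R *+ 2 + 'C(m, r.+2)%:R :> R.
Proof. by rewrite -mulrnA -!natrD !binS; congr (_%:R); lia. Qed.

Lemma bin_central (i : nat) : 'C(i.*2.+1, i) = 'C(i.*2.+1, i.+1).
Proof. by rewrite -bin_sub; [congr binomial; lia | lia]. Qed.

(** The boundary case of [ballot_recr], where the term of index -1 would be a
    difference of the two equal central binomials. *)
Lemma ballot_recl i : ballot i.+1 0 = 2 * ballot i 0 + ballot i 1.
Proof.
rewrite /ballot doubleS !addn0 addn1 !(natr_binSS _ i.*2.+1) bin_central.
ring.
Qed.

Lemma ballot_recr i k :
  ballot i.+1 k.+1 = ballot i k + 2 * ballot i k.+1 + ballot i k.+2.
Proof.
rewrite /ballot doubleS !addSn !addnS !(natr_binSS _ i.*2.+1).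
ring.
Qed.

Lemma ballot_small i k : (i < k)%N -> ballot i k = 0.
Proof. by move=> lt_ik; rewrite /ballot !bin_small ?subrr //; lia. Qed.

Lemma ballot_diag i : ballot i i = 1.
Proof. by rewrite /ballot addnn binn bin_small // subr0. Qed.

Lemma ballot_catalan i : ballot i 0 = catalan i.+1.
Proof.
rewrite /ballot /catalan addn0 doubleS.
have e0 : (i.+2 * 'C(i.*2.+1, i.+2) = i * 'C(i.*2.+1, i.+1))%N.
  by rewrite mul_bin_left; congr (_ * _)%N; lia.
have e1 : 'C(i.*2.+2, i.+1) = ('C(i.*2.+1, i.+1) * 2)%N.
  by rewrite binS bin_central; lia.
have nz : i.+2%:R != 0 :> rat by rewrite Num.Theory.pnatr_eq0.
apply: (canRL (mulfK nz)).
have := congr1 (fun m => m%:R : rat) e0.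
rewrite e1 !natrM mulrBl [_ * i.+2%:R in X in _ - X]mulrC => ->.
rewrite -!natr1; ring.
Qed.

(** Multiplication by x is self-adjoint for the standard pairing in the basis
    (U_k); truncating the sum leaves the boundary term of a telescoping sum, as
    in Green's identity. *)
Lemma ballot_green (i j N : nat) :
  \sum_(k < N.+1) ballot i.+1 k * ballot j k =
  \sum_(k < N.+1) ballot i k * ballot j.+1 k +
  (ballot i N.+1 * ballot j N - ballot i N * ballot j N.+1).
Proof.
elim: N => [|N IH]; first by rewrite !big_ord1 !ballot_recl; ring.
rewrite big_ord_recr [in RHS]big_ord_recr /= IH !ballot_recr; ring.
Qed.

(** L(x^i x^j) computed in the orthonormal basis (U_k): self-adjointness moves
    all powers of x to one factor.  The truncation is harmless once N exceeds one
    of the two degrees. *)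
Lemma ballot_gram (i j N : nat) : (i < N)%N ->
  \sum_(k < N) ballot i k * ballot j k = catalan (i + j).+1.
Proof.
case: N => // N; elim: i j => [|i IH] j lt_iN.
  rewrite big_ord_recl big1 => [|k _]; last by rewrite ballot_small ?mul0r.
  by rewrite /= ballot_diag mul1r addr0 ballot_catalan.
rewrite ballot_green IH 1?ltnW // !(@ballot_small i); try lia.
by rewrite !mul0r subrr addr0 addnS.
Qed.

(** * The Hankel matrix in the orthonormal basis *)

Definition ballot_mx (N : nat) : 'M[rat]_N := \matrix_(i, k) ballot i k.

Lemma det_ballot_mx (N : nat) : \det (ballot_mx N) = 1.
Proof.
rewrite det_trig; last first.
  by apply/is_trig_mxP => i k lt_ik; rewrite mxE ballot_small.
by rewrite big1 // => i _; rewrite mxE ballot_diag.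
Qed.

(** The truncation of multiplication by x acts exactly on the rows of the
    ballot matrix: the only lost coordinate, that of x^N on U_N, lies outside
    the columns. *)
Lemma ballot_mx_tridiag (N : nat) :
  ballot_mx N *m tridiag 2 1 N = \matrix_(i, k) ballot i.+1 k.
Proof.
apply/matrixP => i k; rewrite !mxE.
under eq_bigr => l _ do rewrite !mxE !mulrDr !mulrnAr mulr1 !mulrb.
rewrite !big_split /= -!big_mkcond /=.
have -> : \sum_(l < N | k.+1 == l) ballot i l = ballot i k.+1.
  under eq_bigl => l do rewrite eq_sym.
  rewrite (big_ord1_eq _ (ballot i)); case: ltnP => // le_Nk.
  by rewrite ballot_small // (leq_trans _ le_Nk).
rewrite (big_pred1 k) //; case: k => [[|k] lt_kN] /=.
  by rewrite big_pred0 // ballot_recl; ring.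
under eq_bigl => l do rewrite eqSS.
by rewrite (big_ord1_eq _ (ballot i)) ltnW // ballot_recr; ring.
Qed.

Definition catalan_comb (a b : rat) (k : nat) : rat :=
  a * catalan (k + 2) + b * catalan (k + 3).

(** The Gram identity [ballot_gram] gives every entry, except that in the last
    diagonal one the two factors x^{N+1} of the C_{2N+3} term both have a lost
    coordinate 1 on U_{N+1}, whose product is the correction. *)
Lemma catalan_comb_mx (a b : rat) (N : nat) (i j : 'I_N.+1) :
  catalan_comb a b (i + j) =
  (ballot_mx N.+1 *m (tridiag 2 1 N.+1 *m tridiag (a + 2 * b) b N.+1)
     *m (ballot_mx N.+1)^T) i j + b *+ ((i == ord_max) && (j == ord_max)).
Proof.
have -> : tridiag (a + 2 * b) b N.+1 = a%:M + b *: tridiag 2 1 N.+1.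
  apply/matrixP => k l; rewrite !mxE.
  by case: eqP; case: eqP; case: eqP => _ _ _; rewrite ?mulr1n ?mulr0n; ring.
have trJ : (tridiag 2 1 N.+1)^T = tridiag (2 : rat) 1 N.+1.
  by apply/matrixP => k l; rewrite !mxE eq_sym addrAC.
have -> : ballot_mx N.+1 *m (tridiag 2 1 N.+1 *m (a%:M + b *: tridiag 2 1 N.+1))
     *m (ballot_mx N.+1)^T =
   a *: ((ballot_mx N.+1 *m tridiag 2 1 N.+1) *m (ballot_mx N.+1)^T)
   + b *: ((ballot_mx N.+1 *m tridiag 2 1 N.+1)
            *m (ballot_mx N.+1 *m tridiag 2 1 N.+1)^T).
  rewrite [in RHS]trmx_mul trJ mulmxDr mul_mx_scalar -scalemxAr mulmxDr mulmxDl.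
  by rewrite -!scalemxAr -!scalemxAl !mulmxA.
rewrite ballot_mx_tridiag !mxE /catalan_comb.
have -> : \sum_k (\matrix_(i, k) ballot i.+1 k : 'M_N.+1) i k *
     (ballot_mx N.+1)^T k j = catalan (i + j + 2).
  under eq_bigr => k _ do rewrite !mxE mulrC.
  by rewrite ballot_gram //; congr catalan; lia.
set S := \sum_k _.
suff -> : catalan (i + j + 3) = S + ((i == ord_max) && (j == ord_max))%:R.
  by rewrite mulrDr mulr_natr addrA.
have -> : S = \sum_(k < N.+1) ballot i.+1 k * ballot j.+1 k.
  by apply: eq_bigr => k _; rewrite !mxE.
have e : (i + j + 3 = (i.+1 + j.+1).+1)%N by lia.
rewrite e -!val_eqE /=; case: eqP => [iN|/eqP niN]; last first.
  by rewrite addr0 ballot_gram //; have := ltn_ord i; lia.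
case: eqP => [jN|/eqP njN]; last first.
  under eq_bigr => k _ do rewrite mulrC.
  rewrite addr0 ballot_gram; last by have := ltn_ord j; lia.
  by congr catalan; lia.
(* One more column restores the coordinate lost by the truncation. *)
rewrite iN jN -(@ballot_gram _ _ N.+2) // big_ord_recr /=.
by rewrite !ballot_diag mulr1.
Qed.

Lemma det_add_corner (R : comNzRingType) (n : nat) (A B : 'M[R]_n.+1) (c : R) :
  (forall i j, A i j = B i j + c *+ ((i == ord_max) && (j == ord_max))) ->
  \det A = \det B + c * \det (row' ord_max (col' ord_max A)).
Proof.
move=> defA; have cofE j : cofactor A ord_max j = cofactor B ord_max j.
  congr (_ * \det _); apply/matrixP => i k; rewrite !mxE defA.
  by rewrite [lift _ _ == _]eq_sym (negPf (neq_lift _ _)) addr0.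
have -> : \det (row' ord_max (col' ord_max A)) = cofactor A ord_max ord_max.
  by rewrite /cofactor addnn -signr_odd odd_double expr0 mul1r.
rewrite (expand_det_row A ord_max) (expand_det_row B ord_max).
under eq_bigr => j _ do rewrite cofE defA eqxx mulrDl mulrnAl mulrb.
by rewrite big_split /= -big_mkcond /= big_pred1_eq cofE.
Qed.

(** [hankel s n] is [hankel_minor s n.+1]; the empty minor, equal to 1, starts
    the recurrence below. *)
Definition hankel_minor (R : comNzRingType) (s : nat -> R) (m : nat) : R :=
  \det (\matrix_(i < m, j < m) s (i + j)%N).

Lemma hankel_minor_catalan_rec (a b : rat) (m : nat) :
  hankel_minor (catalan_comb a b) m.+1 =
  m.+2%:R * \det (tridiag (a + 2 * b) b m.+1)
  + b * hankel_minor (catalan_comb a b) m.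
Proof.
rewrite /hankel_minor (det_add_corner
  (B := ballot_mx m.+1 *m (tridiag 2 1 m.+1 *m tridiag (a + 2 * b) b m.+1)
          *m (ballot_mx m.+1)^T) (c := b)); last first.
  by move=> i j; rewrite mxE catalan_comb_mx.
rewrite !det_mulmx det_tr det_ballot_mx mul1r mulr1 det_tridiag21.
congr (_ + _ * \det _); apply/matrixP => i j.
by rewrite !mxE !lift_max.
Qed.

(** * Power series as coefficient sequences *)

(** Transfers ring identities from polynomials, since a coefficient of a product
    depends on finitely many coefficients of the factors. *)
Lemma fps_mul_trunc (R : nzRingType) (F G : fps R) (m k : nat) : (k < m)%N ->
  fps_mul F G k = ((\poly_(i < m) F i) * (\poly_(i < m) G i))`_k.
Proof.
move=> lt_km; rewrite coefM; apply: eq_bigr => i _; rewrite !coef_poly.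
by rewrite !ifT //; have := ltn_ord i; lia.
Qed.

Lemma eq_fps_mul (R : nzRingType) (F F' G G' : fps R) :
  F =1 F' -> G =1 G' -> fps_mul F G =1 fps_mul F' G'.
Proof. by move=> eF eG m; apply: eq_bigr => i _; rewrite eF eG. Qed.

Lemma fps_mulA (R : nzRingType) (F G H : fps R) :
  fps_mul F (fps_mul G H) =1 fps_mul (fps_mul F G) H.
Proof.
move=> m; pose tr (K : fps R) := \poly_(i < m.+1) K i.
have trE K k : (k <= m)%N -> (tr K)`_k = K k.
  by move=> le_km; rewrite coef_poly ltnS le_km.
transitivity (tr F * (tr G * tr H))`_m.
  rewrite coefM; apply: eq_bigr => i _.
  have le_im : (i <= m)%N by rewrite -ltnS.
  by rewrite trE // (@fps_mul_trunc _ G H m.+1) // ltnS leq_subr.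
rewrite mulrA coefM; apply: eq_bigr => i _.
by rewrite (@fps_mul_trunc _ F G m.+1) // trE ?leq_subr.
Qed.

Lemma fps_mulC (R : comNzRingType) (F G : fps R) :
  fps_mul F G =1 fps_mul G F.
Proof. by move=> m; rewrite !(@fps_mul_trunc _ _ _ m.+1) // mulrC. Qed.

Lemma fps_mul1 (R : nzRingType) (F : fps R) :
  fps_mul F (fps_of_poly 1) =1 F.
Proof.
move=> m; rewrite /fps_mul big_ord_recr /= subnn /fps_of_poly coef1 mulr1.
rewrite big1 ?add0r // => i _; rewrite coef1 subn_eq0 leqNgt ltn_ord mulr0 //.
Qed.

Lemma fps_of_polyM (R : nzRingType) (p q : {poly R}) :
  fps_of_poly (p * q) =1 fps_mul (fps_of_poly p) (fps_of_poly q).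
Proof. by move=> m; rewrite /fps_of_poly coefM. Qed.

Lemma fps_div_unique (R : fieldType) (F G K : fps R) :
  G 0%N != 0 -> fps_mul G K =1 F -> K =1 fps_div F G.
Proof.
move=> G0 GK m; rewrite /fps_div -(fps_mul1 K m).
rewrite -(eq_fps_mul (frefl K) (fps_mulV G0)) fps_mulA.
by apply: eq_fps_mul => // k; rewrite fps_mulC GK.
Qed.

(** * The generating function *)

Lemma fps_mul_quad0 (R : comNzRingType) (c d : R) (F : fps R) :
  fps_mul (fps_of_poly (1 - c *: 'X + d *: 'X^2)) F 0 = F 0%N.
Proof.
rewrite /fps_mul big_ord1 /fps_of_poly !coefE /=.
ring.
Qed.

Lemma fps_mul_quad1 (R : comNzRingType) (c d : R) (F : fps R) :
  fps_mul (fps_of_poly (1 - c *: 'X + d *: 'X^2)) F 1 = F 1%N - c * F 0%N.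
Proof.
rewrite /fps_mul !big_ord_recl big_ord0 /fps_of_poly !coefE /=.
ring.
Qed.

Lemma fps_mul_quadSS (R : comNzRingType) (c d : R) (F : fps R) m :
  fps_mul (fps_of_poly (1 - c *: 'X + d *: 'X^2)) F m.+2 =
  F m.+2 - c * F m.+1 + d * F m.
Proof.
rewrite /fps_mul !big_ord_recl big1 => [|i _].
  rewrite /fps_of_poly !coefE /= /bump /= !subSS !subn0.
  ring.
rewrite /fps_of_poly !coefE /=.
ring.
Qed.

Lemma fps_mul_linear0 (R : comNzRingType) (c : R) (F : fps R) :
  fps_mul (fps_of_poly (1 - c *: 'X)) F 0 = F 0%N.
Proof. by rewrite /fps_mul big_ord1 /fps_of_poly !coefE /=; ring. Qed.

Lemma fps_mul_linearS (R : comNzRingType) (c : R) (F : fps R) m :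
  fps_mul (fps_of_poly (1 - c *: 'X)) F m.+1 = F m.+1 - c * F m.
Proof.
rewrite /fps_mul !big_ord_recl big1 => [|i _].
  by rewrite /fps_of_poly !coefE /= /bump /= !subSS !subn0; ring.
by rewrite /fps_of_poly !coefE /=; ring.
Qed.

(** With W = sum w_m x^m the inverse of P = 1 - x X + y^2 X^2, this is
    (X W)' = (P - X P') / P^2.  Multiplying by P twice applies the recurrence
    operator twice; the double root makes the weights m + 1 cancel, leaving
    four initial coefficients. *)
Lemma weighted_tridiag_gf (R : comNzRingType) (x y : R) :
  fps_mul (fps_of_poly (1 - x *: 'X + y ^+ 2 *: 'X^2))
    (fps_mul (fps_of_poly (1 - x *: 'X + y ^+ 2 *: 'X^2))
       (fun m => m.+1%:R * \det (tridiag x y m)))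
  =1 fps_of_poly (1 - y ^+ 2 *: 'X^2).
Proof.
case=> [|[|[|[|m]]]]; rewrite ?fps_mul_quadSS ?fps_mul_quad1 ?fps_mul_quad0;
  rewrite ?det_tridiagSS ?det_tridiag1 ?det_tridiag0 -?natr1;
  rewrite /fps_of_poly !coefE /=; ring.
Qed.

Theorem proposition15 (a b : rat) (n : nat) :
  hankel (fun k : nat => a * catalan (k + 2) + b * catalan (k + 3)) n =
  fps_coef n.+1
    (fps_div
       (fps_of_poly (1 - b ^+ 2 *: 'X^2))
       (fps_of_poly
          (1 - (2 * a + 5 * b) *: 'X
             + (a ^+ 2 + 6 * a * b + 10 * b ^+ 2) *: 'X^2
             - ((a ^+ 2 + 6 * a * b + 10 * b ^+ 2) * b) *: 'X^3
             + ((2 * a + 5 * b) * b ^+ 3) *: 'X^4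
             - b ^+ 5 *: 'X^5))).
Proof.
set den := (_ - b ^+ 5 *: 'X^5).
pose P : {poly rat} := 1 - (a + 2 * b) *: 'X + b ^+ 2 *: 'X^2.
(* The factorization exhibits the three recurrence operators to be undone. *)
have denE : den = P * (P * (1 - b *: 'X)).
  by rewrite /den /P -!mul_polyC !(rmorphD, rmorphM, rmorphXn) /=; ring.
have den0 : fps_of_poly den 0%N != 0.
  by rewrite /fps_of_poly /den !coefE /= !(mulr0, addr0, subr0).
rewrite /fps_coef.
have <- := @fps_div_unique _ _ _ (hankel_minor (catalan_comb a b)) den0.
  by [].
move=> m; rewrite -(weighted_tridiag_gf (a + 2 * b)) denE.
rewrite (eq_fps_mul (fps_of_polyM _ _) (frefl _)) -fps_mulA.
apply: eq_fps_mul => // {}m.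
rewrite (eq_fps_mul (fps_of_polyM _ _) (frefl _)) -fps_mulA.
apply: eq_fps_mul => // -[|{}m].
  by rewrite fps_mul_linear0 /hankel_minor !det_mx00 mulr1.
by rewrite fps_mul_linearS hankel_minor_catalan_rec addrK.
Qed.
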